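(* Let $(N_1,C_1)$ and $(N_2,C_2)$ be coherent nets, where $C_1,C_2$ are Presburger formulas over the places of $N_1,N_2$, and let $E$ be a Presburger formula with free variables in $P_1\cup P_2$. For $i=1,2$ let $\tau^*_{C_i}$ be a Presburger formula such that for every marking $m\models C_i$ of $N_i$ and every marking $m'$, $\tau^*_{C_i}(m,m')$ holds iff $m\xRightarrow{\epsilon}m'$ in $N_i$. If $(N_1,C_1)\preceq_E(N_2,C_2)$, then the following formulas are all valid: (Core 0), for each $i\in\{1,2\}$: $\forall\vec p,\vec p',a.\ C_i(\vec p)\wedge\overleftarrow{T}_{C_i}(\vec p,\vec p',a)\implies\exists\vec p''.\ C_i(\vec p'')\wedge\overleftarrow{T}_{C_i}(\vec p,\vec p'',a)\wedge\tau^*_{C_i}(\vec p'',\vec p')$ (built from $N_i$); (Core 1) $\forall\vec x.\ C_1(\vec x)\implies\exists\vec y.\ \tilde E(\vec x,\vec y)\wedge C_2(\vec y)$; (Core 2) $\forall\vec p_1,\vec p_2,\vec p_1'.\ \tilde E(\vec p_1,\vec p_2)\wedge\tau_1(\vec p_1,\vec p_1')\implies\tilde E(\vec p_1',\vec p_2)$; (Core 3) $\forall\vec p_1,\vec p_2,a,\vec p_1',\vec p_2'.\ C_1(\vec p_1)\wedge\tilde E(\vec p_1,\vec p_2)\wedge C_2(\vec p_2)\wedge\hat T_{C_1}(\vec p_1,\vec p_1',a)\wedge\tilde E(\vec p_1',\vec p_2')\implies\hat T_{C_2}(\vec p_2,\vec p_2',a)$.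
   Context: A labeled Petri net $N=(P,T,\mathrm{Pre},\mathrm{Post})$ has finite place set $P=\{p_1,\dots,p_n\}$, finite transition set $T$, $\mathrm{Pre},\mathrm{Post}:T\to(P\to\mathbb N)$, and labeling $l:T\to\Sigma\cup\{\tau\}$, $\tau$ silent. Labels are encoded as natural numbers: $\Sigma\subseteq\mathbb N\setminus\{0\}$, $\tau$ encoded by $0$. Markings $m:P\to\mathbb N$ are identified with vectors. $t$ is enabled at $m$ if $m\ge\mathrm{Pre}(t)$, and then $m\xrightarrow{t}m'$ with $m'=m-\mathrm{Pre}(t)+\mathrm{Post}(t)$; $m\xRightarrow{\varrho}m'$ is firing along $\varrho\in T^*$. Extend $l$ to $T^*$ by erasing $\tau$. For $\sigma\in\Sigma^*$, $m\xRightarrow{\sigma}m'$ means some $\varrho$ with $l(\varrho)=\sigma$ has $m\xRightarrow{\varrho}m'$ ($m\xRightarrow{\epsilon}m'$: silent reachability). $m\overset{\epsilon}{\twoheadrightarrow}m'$ iff $m=m'$; for $\sigma\in\Sigma^*,a\in\Sigma$, $m\overset{\sigma a}{\twoheadrightarrow}m'$ iff there exist $m''$, $t$ with $l(t)=a$ and $m\xRightarrow{\sigma}m''\xrightarrow{t}m'$. $(N,C)$ is a coherent net if for every $m\models C$, $\sigma\in\Sigma^*$, $m\xRightarrow{\sigma}m'$ there is $m''\models C$ with $m\overset{\sigma}{\twoheadrightarrow}m''$ and $m''\xRightarrow{\epsilon}m'$. For a net $N$: $\mathrm{ENBL}_t(\vec x)\triangleq\bigwedge_i x_i\ge\mathrm{Pre}(t,p_i)$;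 $\Delta_t(\vec x,\vec x')\triangleq\bigwedge_i x_i'=x_i+\mathrm{Post}(t,p_i)-\mathrm{Pre}(t,p_i)$; $T(\vec x,\vec x',a)\triangleq\bigvee_{t\in T,\,l(t)\ne\tau}(\mathrm{ENBL}_t\wedge\Delta_t\wedge a=l(t))$; $\tau(\vec x,\vec x')\triangleq\bigvee_{t\in T,\,l(t)=\tau}(\mathrm{ENBL}_t(\vec x)\wedge\Delta_t(\vec x,\vec x'))$ ($\tau_1$ is this formula for $N_1$); $\overleftarrow{T}_C(\vec x,\vec x',a)\triangleq\exists\vec x''.\tau^*_C(\vec x,\vec x'')\wedge T(\vec x'',\vec x',a)$; $\hat T_C(\vec x,\vec x',a)\triangleq(\exists\vec x_1.\overleftarrow{T}_C(\vec x,\vec x_1,a)\wedge C(\vec x_1)\wedge\tau^*_C(\vec x_1,\vec x'))\vee(a=0\wedge\tau^*_C(\vec x,\vec x'))$. All variables range over $\mathbb N$ and ''valid'' means true for all assignments. $\tilde E(\vec x,\vec y)$ is $E$ with places of $N_1$ replaced by variables $\vec x$, places of $N_2$ replaced by $\vec y$ (bound variables renamed apart), conjoined with $x_i=y_j$ whenever place $p^1_i$ of $N_1$ equals place $p^2_j$ of $N_2$. For markings $m_1,m_2$, $m_1\equiv_E m_2$ means $\tilde E(m_1,m_2)$ holds, and $m_1\langle C_1EC_2\rangle m_2$ means $m_1\models C_1$, $m_1\equiv_E m_2$, $m_2\models C_2$. $(N_1,C_1)\preceq_E(N_2,C_2)$ means: (S1) for every $m_1\models C_1$ there is $m_2$ with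 $m_1\langle C_1EC_2\rangle m_2$; (S2) for all $m_1\xRightarrow{\epsilon}m_1'$ in $N_1$ and all $m_2$, $m_1\equiv_E m_2$ implies $m_1'\equiv_E m_2$; (S3) for all $\sigma\in\Sigma^*$, $m_1\xRightarrow{\sigma}m_1'$ in $N_1$ and $m_2,m_2'$ with $m_1\langle C_1EC_2\rangle m_2$ and $m_1'\equiv_E m_2'$, we have $m_2\xRightarrow{\sigma}m_2'$ in $N_2$. *)

(* Defs.v *)
From HB Require Import structures.
From mathcomp Require Import all_boot all_order all_algebra.
From mathcomp Require Import finmap.

Set Implicit Arguments.
Unset Strict Implicit.
Unset Printing Implicit Defensive.

(* Presburger formulas, well scoped: [pform V] is the type of formulas whose free
   variables belong to V.  Terms denote integers, variables range over the
   naturals.  A quantifier binds a finite block B of variables at once, so that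
   in its body [inl v] is an outer variable and [inr b] a bound one; renaming
   is then capture-avoiding by construction. *)
Inductive pterm (V : Type) : Type :=
| TVar of V
| TCst of int
| TAdd of pterm V & pterm V
| TSub of pterm V & pterm V
| TScale of int & pterm V.

Inductive pform (V : Type) : Type :=
| FTrue
| FFalse
| FEq of pterm V & pterm V
| FLe of pterm V & pterm V
| FNot of pform V
| FAnd of pform V & pform V
| FOr of pform V & pform V
| FImp of pform V & pform V
| FEx (B : finType) of pform (V + B)
| FAll (B : finType) of pform (V + B).

Arguments TCst {V}.
Arguments FTrue {V}.
Arguments FFalse {V}.
Arguments FEx {V} B.
Arguments FAll {V} B.

Definition scase (A B : Type) (R : Type) (f : A -> R) (g : B -> R)
    (s : A + B) : R :=
  match s with inl a => f a | inr b => g b end.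

Fixpoint eval (V : Type) (e : V -> nat) (t : pterm V) : int :=
  match t with
  | TVar v => Posz (e v)
  | TCst z => z
  | TAdd t1 t2 => (eval e t1 + eval e t2)%R
  | TSub t1 t2 => (eval e t1 - eval e t2)%R
  | TScale z t1 => (z * eval e t1)%R
  end.

Fixpoint sat (V : Type) (e : V -> nat) (f : pform V) {struct f} : Prop :=
  match f with
  | FTrue => True
  | FFalse => False
  | FEq t1 t2 => eval e t1 = eval e t2
  | FLe t1 t2 => (eval e t1 <= eval e t2)%R
  | FNot f1 => ~ sat e f1
  | FAnd f1 f2 => sat e f1 /\ sat e f2
  | FOr f1 f2 => sat e f1 \/ sat e f2
  | FImp f1 f2 => sat e f1 -> sat e f2
  | FEx B f1 => exists x : {ffun B -> nat}, sat (scase e x) f1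
  | FAll B f1 => forall x : {ffun B -> nat}, sat (scase e x) f1
  end.

Definition valid (V : Type) (f : pform V) : Prop := forall e : V -> nat, sat e f.

Fixpoint rename_term (V W : Type) (r : V -> W) (t : pterm V) : pterm W :=
  match t with
  | TVar v => TVar (r v)
  | TCst z => TCst z
  | TAdd t1 t2 => TAdd (rename_term r t1) (rename_term r t2)
  | TSub t1 t2 => TSub (rename_term r t1) (rename_term r t2)
  | TScale z t1 => TScale z (rename_term r t1)
  end.

Fixpoint rename (V W : Type) (r : V -> W) (f : pform V) {struct f} : pform W :=
  match f with
  | FTrue => FTrue
  | FFalse => FFalse
  | FEq t1 t2 => FEq (rename_term r t1) (rename_term r t2)
  | FLe t1 t2 => FLe (rename_term r t1) (rename_term r t2)
  | FNot f1 => FNot (rename r f1)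
  | FAnd f1 f2 => FAnd (rename r f1) (rename r f2)
  | FOr f1 f2 => FOr (rename r f1) (rename r f2)
  | FImp f1 f2 => FImp (rename r f1) (rename r f2)
  | FEx B f1 => FEx B (rename (scase (fun v => inl (r v)) inr) f1)
  | FAll B f1 => FAll B (rename (scase (fun v => inl (r v)) inr) f1)
  end.

Definition FConj (V : Type) (s : seq (pform V)) : pform V :=
  foldr (@FAnd V) FTrue s.
Definition FDisj (V : Type) (s : seq (pform V)) : pform V :=
  foldr (@FOr V) FFalse s.

(* K is the universe of place names, so that two nets may share places; the
   silent label is 0. *)
Record net (K : choiceType) (Sigma : pred nat) := Net {
  places : {fset K};
  trans : finType;
  pre : trans -> places -> nat;
  post : trans -> places -> nat;
  label : trans -> nat;
  labelP : forall t, (label t == 0) || (label t \in Sigma)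
}.

Definition place (K : choiceType) (Sigma : pred nat) (N : net K Sigma)
  : finType := places N.

Section Nets.

Variables (K : choiceType) (Sigma : pred nat).

Definition marking (N : net K Sigma) := {ffun place N -> nat}.

Section Semantics.

Variable N : net K Sigma.
Implicit Types (m : marking N) (t : trans N) (C : pform (place N)).

Definition enabled m t : Prop := forall p, pre t p <= m p.

Definition fire m t m' : Prop :=
  enabled m t /\ m' = [ffun p => m p - pre t p + post t p].

Fixpoint run m (rho : seq (trans N)) m' : Prop :=
  match rho with
  | [::] => m = m'
  | t :: rho' => exists m1, fire m t m1 /\ run m1 rho' m'
  end.

Definition word (rho : seq (trans N)) : seq nat :=
  [seq a <- [seq label t | t <- rho] | a != 0].

Definition wreach m (s : seq nat) m' : Prop :=
  exists rho, word rho = s /\ run m rho m'.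

(* The relation written with a two-headed arrow: no silent transition after the
   last visible one. *)
Inductive treach m : seq nat -> marking N -> Prop :=
| treach_nil : treach m [::] m
| treach_rcons s a m'' t m' :
    a \in Sigma -> label t = a -> wreach m s m'' -> fire m'' t m' ->
    treach m (rcons s a) m'.

Definition coherent C : Prop :=
  forall m s m', sat m C -> all (mem Sigma) s -> wreach m s m' ->
  exists m'', [/\ sat m'' C, treach m s m'' & wreach m'' [::] m'].

(* In [tauS : pform (place N + place N)], [inl p] is the variable of p in the
   source marking and [inr p] the one in the target marking. *)
Definition silent_reach_formula C (tauS : pform (place N + place N)) : Prop :=
  forall m m', sat m C -> (sat (scase m m') tauS <-> wreach m [::] m').

(* The formulas below are parameterized by the vectors of variables (and the
   variable a) they are applied to, in an arbitrary scope V. *)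
Section Formulas.

Variable V : Type.
Implicit Types (x : place N -> V) (a : V).

Definition ENBL t x : pform V :=
  FConj [seq FLe (TCst (Posz (pre t p))) (TVar (x p)) | p <- enum (place N)].

Definition DELTA t x x' : pform V :=
  FConj [seq FEq (TVar (x' p))
                 (TSub (TAdd (TVar (x p)) (TCst (Posz (post t p))))
                       (TCst (Posz (pre t p)))) | p <- enum (place N)].

Definition Tform x x' a : pform V :=
  FDisj [seq FAnd (FAnd (ENBL t x) (DELTA t x x'))
                  (FEq (TVar a) (TCst (Posz (label t))))
        | t <- enum (trans N) & label t != 0].

Definition tauform x x' : pform V :=
  FDisj [seq FAnd (ENBL t x) (DELTA t x x')
        | t <- enum (trans N) & label t == 0].

Definition appC C x : pform V := rename x C.

Definition app_tauS (tauS : pform (place N + place N)) x x' : pform V :=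
  rename (scase x x') tauS.

End Formulas.

Definition Tback (tauS : pform (place N + place N)) (V : Type)
    (x x' : place N -> V) (a : V) : pform V :=
  FEx (place N)
    (FAnd (app_tauS tauS (fun p => inl (x p)) inr)
          (Tform inr (fun p => inl (x' p)) (inl a))).

Definition That C (tauS : pform (place N + place N)) (V : Type)
    (x x' : place N -> V) (a : V) : pform V :=
  FOr
    (FEx (place N)
      (FAnd (Tback tauS (fun p => inl (x p)) inr (inl a))
        (FAnd (appC C inr)
              (app_tauS tauS inr (fun p => inl (x' p))))))
    (FAnd (FEq (TVar a) (TCst (Posz 0))) (app_tauS tauS x x')).

End Semantics.

Section Equivalence.

Variables N1 N2 : net K Sigma.

Definition allplace : finType := (places N1 `|` places N2)%fset.

Lemma allplace_right (v : allplace) :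
  val v \notin places N1 -> val v \in places N2.
Proof. by have := valP v; rewrite in_fsetU => /orP[->|]. Qed.

(* A shared place is sent to N1; the equalities in [Etilde] make this choice
   immaterial. *)
Definition side (v : allplace) : place N1 + place N2 :=
  match boolP (val v \in places N1) with
  | AltTrue h => inl [` h]%fset
  | AltFalse h => inr [` allplace_right h]%fset
  end.

Definition Etilde (E : pform allplace) (V : Type)
    (x : place N1 -> V) (y : place N2 -> V) : pform V :=
  FAnd (rename (fun v => scase x y (side v)) E)
       (FConj [seq FEq (TVar (x pq.1)) (TVar (y pq.2))
              | pq <- enum {: place N1 * place N2}
                & val pq.1 == val pq.2]).

Definition Eequiv (E : pform allplace) (m1 : marking N1) (m2 : marking N2)
  : Prop := sat (scase m1 m2) (Etilde E inl inr).

Definition CECequiv (C1 : pform (place N1)) (E : pform allplace)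
    (C2 : pform (place N2)) (m1 : marking N1) (m2 : marking N2) : Prop :=
  [/\ sat m1 C1, Eequiv E m1 m2 & sat m2 C2].

Definition abstracts (C1 : pform (place N1)) (E : pform allplace)
    (C2 : pform (place N2)) : Prop :=
  [/\ forall m1 : marking N1, sat m1 C1 ->
        exists m2 : marking N2, CECequiv C1 E C2 m1 m2,
      forall m1 m1' : marking N1, wreach m1 [::] m1' ->
        forall m2 : marking N2, Eequiv E m1 m2 -> Eequiv E m1' m2
    & forall s, all (mem Sigma) s ->
        forall m1 m1' : marking N1, wreach m1 s m1' ->
        forall m2 m2' : marking N2,
        CECequiv C1 E C2 m1 m2 -> Eequiv E m1' m2' -> wreach m2 s m2'].

End Equivalence.

(* The core formulas are closed.  The universally quantified vectors form a
   single block, a nested sum listing them in order; [unit] holds the label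
   variable a. *)
Definition core0 (N : net K Sigma) (C : pform (place N))
    (tauS : pform (place N + place N)) : pform void :=
  FAll (place N + place N + unit)%type
    (let p i := inr (inl (inl i)) in
     let p' i := inr (inl (inr i)) in
     let a := inr (inr tt) in
     FImp (FAnd (appC C p) (Tback tauS p p' a))
          (FEx (place N)
            (FAnd (appC C inr)
              (FAnd (Tback tauS (fun i => inl (p i)) inr (inl a))
                    (app_tauS tauS inr (fun i => inl (p' i))))))).

Definition core1 (N1 N2 : net K Sigma) (C1 : pform (place N1))
    (E : pform (allplace N1 N2)) (C2 : pform (place N2)) : pform void :=
  FAll (place N1)
    (FImp (appC C1 inr)
          (FEx (place N2)
            (FAnd (Etilde E (fun i => inl (inr i)) inr) (appC C2 inr)))).

Definition core2 (N1 N2 : net K Sigma) (E : pform (allplace N1 N2))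
  : pform void :=
  FAll (place N1 + place N2 + place N1)%type
    (let p1 i := inr (inl (inl i)) in
     let p2 j := inr (inl (inr j)) in
     let p1' i := inr (inr i) in
     FImp (FAnd (Etilde E p1 p2) (tauform p1 p1')) (Etilde E p1' p2)).

Definition core3 (N1 N2 : net K Sigma) (C1 : pform (place N1))
    (tauS1 : pform (place N1 + place N1)) (E : pform (allplace N1 N2))
    (C2 : pform (place N2)) (tauS2 : pform (place N2 + place N2)) : pform void :=
  FAll (place N1 + place N2 + unit + place N1 + place N2)%type
    (let p1 i := inr (inl (inl (inl (inl i)))) in
     let p2 j := inr (inl (inl (inl (inr j)))) in
     let a := inr (inl (inl (inr tt))) in
     let p1' i := inr (inl (inr i)) in
     let p2' j := inr (inr j) in
     FImp (FAnd (appC C1 p1)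
            (FAnd (Etilde E p1 p2)
              (FAnd (appC C2 p2)
                (FAnd (That C1 tauS1 p1 p1' a) (Etilde E p1' p2')))))
          (That C2 tauS2 p2 p2' a)).

End Nets.

(* Main.v *)
Require Import Defs.
From mathcomp Require Import all_boot.
From mathcomp Require Import finmap.
From mathcomp Require Import all_order all_algebra zify.

(** The step formula [Tback] interprets the relation "silent run, then one
    visible transition", which on a one-letter word is the two-headed arrow, and
    [That] interprets reachability along a word of length at most one (the value
    [a = 0] coding the empty word).  Core 0 is therefore coherence for one-letter
    words.  Core 2 is (S2) for runs of length one.  Core 3 is (S3) for words of
    length at most one, where coherence of the second net cuts the run obtained
    on a letter into [Tback], a marking of [C2] and a silent run. *)

Set Implicit Arguments.
Unset Strict Implicit.
Unset Printing Implicit Defensive.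

(** * Satisfaction under renaming, finite conjunctions and finite disjunctions *)

Lemma eval_rename (V W : Type) (r : V -> W) (e : W -> nat) (e' : V -> nat)
    (t : pterm V) :
  e \o r =1 e' -> eval e (rename_term r t) = eval e' t.
Proof.
move=> ee'; elim: t => //= [v|t1 -> t2 ->|t1 -> t2 ->|z t ->] //.
by rewrite -ee'.
Qed.

(** Asking only for pointwise agreement with [e \o r] keeps the induction going under quantifiers
    without function extensionality, and lets [e'] be a marking, which is a finite function. *)
Lemma sat_rename (V W : Type) (r : V -> W) (e : W -> nat) (e' : V -> nat)
    (f : pform V) :
  e \o r =1 e' -> sat e (rename r f) <-> sat e' f.
Proof.
elim: f W r e e' => //=
  [V' t1 t2|V' t1 t2|V' f IHf|V' f IHf g IHg|V' f IHf g IHg|V' f IHf g IHg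
  |V' B f IHf|V' B f IHf] W r e e' ee'.
- by rewrite !(eval_rename _ ee').
- by rewrite !(eval_rename _ ee').
- by have := IHf _ _ _ _ ee'; tauto.
- by have := IHf _ _ _ _ ee'; have := IHg _ _ _ _ ee'; tauto.
- by have := IHf _ _ _ _ ee'; have := IHg _ _ _ _ ee'; tauto.
- by have := IHf _ _ _ _ ee'; have := IHg _ _ _ _ ee'; tauto.
- have h (x : {ffun B -> nat}) :
    scase e x \o scase (fun v => inl (r v)) inr =1 scase e' x.
    by case=> //= v; rewrite -ee'.
  by split=> -[x /(IHf _ _ _ _ (h x)) ?]; exists x.
- have h (x : {ffun B -> nat}) :
    scase e x \o scase (fun v => inl (r v)) inr =1 scase e' x.
    by case=> //= v; rewrite -ee'.
  by split=> H x; apply/(IHf _ _ _ _ (h x)).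
Qed.

(** Supplies the agreement hypothesis for the variables of the innermost bound block. *)
Lemma scase_inr (A : Type) (B : finType) (e : A -> nat) (m : {ffun B -> nat}) :
  scase e m \o inr =1 m.
Proof. by []. Qed.

Lemma sat_FConj (V : Type) (I : eqType) (e : V -> nat) (F : I -> pform V)
    (s : seq I) :
  sat e (FConj [seq F i | i <- s]) <-> {in s, forall i, sat e (F i)}.
Proof.
elim: s => [|i s IHs] //=; split=> [[Fi /IHs Fs] j|Fs].
  by rewrite inE => /predU1P[->|/Fs].
split; first by apply: Fs; rewrite mem_head.
by apply/IHs => j js; apply: Fs; rewrite inE js orbT.
Qed.

Lemma sat_FDisj (V : Type) (I : eqType) (e : V -> nat) (F : I -> pform V)
    (s : seq I) :
  sat e (FDisj [seq F i | i <- s]) <-> exists2 i, i \in s & sat e (F i).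
Proof.
elim: s => [|i s IHs] /=; first by split=> // -[].
split=> [[Fi|/IHs[j js Fj]]|[j]].
- by exists i; rewrite ?mem_head.
- by exists j; rewrite // inE js orbT.
- by rewrite inE => /predU1P[-> ?|js Fj]; [left | right; apply/IHs; exists j].
Qed.

(** * Runs and observed words of a single net *)

Section Semantics.

Variables (K : choiceType) (Sigma : pred nat) (N : net K Sigma).
Implicit Types (m : marking N) (C : pform (place N)) (t : trans N).

Lemma run_cat m m1 m2 (r1 r2 : seq (trans N)) :
  run m r1 m1 -> run m1 r2 m2 -> run m (r1 ++ r2) m2.
Proof.
elim: r1 m => [|t r1 IHr] m /= => [-> //|[m3 [mt r13]] r2P].
by exists m3; split=> //; apply: IHr.
Qed.

Lemma wreach_cat m m1 m2 (s1 s2 : seq nat) :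
  wreach m s1 m1 -> wreach m1 s2 m2 -> wreach m (s1 ++ s2) m2.
Proof.
move=> [r1 [<- r1P]] [r2 [<- r2P]]; exists (r1 ++ r2); split.
  by rewrite /word map_cat filter_cat.
exact: run_cat r1P r2P.
Qed.

(** Leaving the word as a filter covers silent and visible transitions at once. *)
Lemma wreach_fire m t m' :
  fire m t m' -> wreach m [seq a <- [:: label t] | a != 0] m'.
Proof. by move=> mt; exists [:: t]; split=> //; exists m'. Qed.

Lemma wreach_step m m1 t m' :
  wreach m [::] m1 -> label t != 0 -> fire m1 t m' -> wreach m [:: label t] m'.
Proof.
by move=> mm1 t0 /wreach_fire; rewrite /= t0; apply: (wreach_cat mm1).
Qed.

Lemma label_visible t : label t != 0 -> label t \in Sigma.
Proof. by case/orP: (labelP t) => // ->. Qed.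

Lemma treach1_inv m a m' :
  treach m [:: a] m' ->
  exists m1 t, [/\ wreach m [::] m1, label t = a & fire m1 t m'].
Proof.
(* The index is generalized to a variable that keeps an equation with [[:: a]]. Since [[:: a]] is
   [rcons [::] a], injectivity then forces the prefix [s] to be empty, so the run before [t] is
   silent. *)
move=> h; move: {-2}[:: a] h (erefl [:: a]) => w [//|] {w m'}.
move=> s b m1 t m' _ tb ms mt; case/(@rcons_inj _ [::] s a b)=> ? ?.
by subst; exists m1, t.
Qed.

(** * Semantics of the transition formulas *)

Section Formulas.

Variables (V : Type) (e : V -> nat) (x x' : place N -> V) (m m' : marking N).
Hypotheses (xm : e \o x =1 m) (xm' : e \o x' =1 m').

Lemma sat_appC C : sat e (appC C x) <-> sat m C.
Proof. exact: sat_rename. Qed.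

Lemma sat_app_tauS tauS :
  sat e (app_tauS tauS x x') <-> sat (scase m m') tauS.
Proof. by apply: sat_rename => -[] p /=; [apply: xm|apply: xm']. Qed.

Lemma sat_fire t :
  sat e (ENBL t x) /\ sat e (DELTA t x x') <-> fire m t m'.
Proof.
split=> [[/sat_FConj en /sat_FConj dl]|[en m'E]].
  (* Enabledness comes first: [DELTA] is an equation over the integers, and it matches the truncated
     subtraction in [fire] only when [pre t p <= m p]. *)
  have enb : enabled m t.
    move=> p; have := en p (mem_enum _ _); rewrite /= -xm /=; lia.
  split=> //; apply/ffunP=> p; rewrite ffunE.
  have := dl p (mem_enum _ _); have := enb p; rewrite /= -xm -xm' /=; lia.
split; apply/sat_FConj=> p _ /=; have := en p; rewrite -xm /=; first lia.
have /= -> := xm' p; rewrite m'E ffunE -xm /=; lia.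
Qed.

Lemma sat_Tform a :
  sat e (Tform x x' a) <->
  exists t, [/\ label t != 0, fire m t m' & e a = label t].
Proof.
split=> [/sat_FDisj[t] | [t [t0 mt at_]]].
  rewrite mem_filter => /andP[t0 _] /= [/sat_fire mt [at_]].
  by exists t.
apply/sat_FDisj; exists t; first by rewrite mem_filter t0 mem_enum.
by split; [apply/sat_fire | rewrite /= at_].
Qed.

Lemma sat_tauform :
  sat e (tauform x x') <-> exists2 t, label t = 0 & fire m t m'.
Proof.
split=> [/sat_FDisj[t] | [t t0 mt]].
  by rewrite mem_filter => /andP[/eqP t0 _] /sat_fire mt; exists t.
apply/sat_FDisj; exists t; first by rewrite mem_filter t0 mem_enum.
exact/sat_fire.
Qed.

End Formulas.

(** * Semantics of a silent run followed by a visible transition *)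

Section Steps.

Variables (C : pform (place N)) (tauS : pform (place N + place N)).
Hypothesis tauSP : silent_reach_formula C tauS.
Variables (V : Type) (e : V -> nat) (x x' : place N -> V) (a : V).
Variables m m' : marking N.
Hypotheses (xm : e \o x =1 m) (xm' : e \o x' =1 m') (Cm : sat m C).

Lemma sat_silent : sat e (app_tauS tauS x x') <-> wreach m [::] m'.
Proof. by rewrite (sat_app_tauS xm xm'); apply: tauSP. Qed.

(** The formula [tauS] is exact here because the silent run starts at [m], which satisfies [C];
    nothing is asked of the intermediate marking [m1]. *)
Lemma sat_Tback :
  sat e (Tback tauS x x' a) <->
  exists m1 t, [/\ wreach m [::] m1, label t != 0, fire m1 t m'
                 & e a = label t].
Proof.
have xmE m1 : scase e m1 \o (fun p => inl (x p)) =1 m by [].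
have xmE' m1 : scase e m1 \o (fun p => inl (x' p)) =1 m' by [].
split=> [[m1 [ms mt]]|[m1 [t [ms t0 mt ta]]]].
  have {}ms := (sat_app_tauS (xmE m1) (scase_inr _ m1) _).1 ms.
  have [t [t0 {}mt ta]] := (sat_Tform (scase_inr _ m1) (xmE' m1) _).1 mt.
  by exists m1, t; split=> //; apply/tauSP.
exists m1; split.
  by apply/(sat_app_tauS (xmE m1) (scase_inr _ m1)); apply/tauSP.
by apply/(sat_Tform (scase_inr _ m1) (xmE' m1)); exists t.
Qed.

Lemma sat_Tback_wreach :
  sat e (Tback tauS x x' a) ->
  [/\ e a != 0, e a \in Sigma & wreach m [:: e a] m'].
Proof.
move=> /sat_Tback[m1 [t [ms t0 mt ->]]].
by split; [|apply: label_visible|apply: wreach_step mt].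
Qed.

Lemma sat_Tback_treach :
  e a != 0 -> treach m [:: e a] m' -> sat e (Tback tauS x x' a).
Proof.
move=> a0 /treach1_inv[m1 [t [ms ta mt]]].
by apply/sat_Tback; exists m1, t; rewrite ta.
Qed.

End Steps.

(** * Consequences of coherence for words of length at most one *)

Section Coherent.

Variables (C : pform (place N)) (tauS : pform (place N + place N)).
Hypotheses (tauSP : silent_reach_formula C tauS) (cohC : coherent C).

(** The conclusions are stated inside the scope of a bound block, so that [m1] directly witnesses
    the existential quantifier both of [core0] and of the first disjunct of [That]. *)
Lemma coherent_letter (V : Type) (e : V -> nat) (x x' : place N -> V) (a : V)
    m m' :
  e \o x =1 m -> e \o x' =1 m' -> sat m C ->
  e a != 0 -> e a \in Sigma -> wreach m [:: e a] m' ->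
  exists m1 : marking N,
    [/\ sat (scase e m1) (appC C inr),
        sat (scase e m1) (Tback tauS (fun p => inl (x p)) inr (inl a))
      & sat (scase e m1) (app_tauS tauS inr (fun p => inl (x' p)))].
Proof.
move=> xm xm' Cm a0 aS ma.
have [|m1 [Cm1 mm1 m1m']] := cohC Cm _ ma; first by rewrite /= andbT.
exists m1; split.
- exact/(sat_appC (scase_inr _ m1)).
- exact: (sat_Tback_treach (m := m) (m' := m1) tauSP).
- by apply/(sat_silent tauSP (scase_inr _ m1) (m' := m') _ Cm1).
Qed.

(** The right-hand side mentions neither [C] nor [tauS], so a word obtained in one net can be
    carried to the other. From left to right, runs are concatenated, the silent one being read at
    [m1], which satisfies [C]; coherence enters in the letter case of the converse. *)
Lemma sat_That (V : Type) (e : V -> nat) (x x' : place N -> V) (a : V) m m' :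
  e \o x =1 m -> e \o x' =1 m' -> sat m C ->
  sat e (That C tauS x x' a) <->
  exists s, [/\ all (mem Sigma) s, wreach m s m'
    & (s = [::] /\ e a = 0) \/ (s = [:: e a] /\ e a != 0)].
Proof.
move=> xm xm' Cm; split=> [[[m1 [mm1 [Cm1 m1m']]]|[[a0] mm']]|].
- have {}Cm1 := (sat_appC (scase_inr _ m1) _).1 Cm1.
  have [a0 aS {}mm1] : [/\ e a != 0, e a \in Sigma & wreach m [:: e a] m1].
    exact: (sat_Tback_wreach tauSP _ (scase_inr _ m1) Cm mm1).
  have {}m1m' : wreach m1 [::] m'.
    exact: (sat_silent tauSP (scase_inr _ m1) _ Cm1).1 m1m'.
  exists [:: e a]; split; [by rewrite /= andbT | | by right].
  exact: (wreach_cat mm1 m1m').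
- by exists [::]; split; [| exact/(sat_silent tauSP xm xm') | left].
- move=> [s [sS mm' [[s0 a0]|[sa a0]]]]; subst s.
    by right; split; [rewrite /= a0 | apply/(sat_silent tauSP xm xm')].
  have [|m1 [Cm1 mm1 m1m']] := coherent_letter xm xm' Cm a0 _ mm'.
    by move: sS; rewrite /= andbT.
  by left; exists m1.
Qed.

Lemma valid_core0 : valid (core0 C tauS).
Proof.
move=> e0 v /=; set e := scase e0 v => -[Cp pp'].
(* The quantified block is one finite function on a nested sum; its components are repackaged as
   markings that agree pointwise with the variables. *)
pose m : marking N := [ffun i => v (inl (inl i))].
pose m' : marking N := [ffun i => v (inl (inr i))].
have xm : e \o (fun i => inr (inl (inl i))) =1 m by move=> i; rewrite ffunE.
have xm' : e \o (fun i => inr (inl (inr i))) =1 m' by move=> i; rewrite ffunE.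
have Cm := (sat_appC xm _).1 Cp.
have [a0 aS mm'] := sat_Tback_wreach tauSP xm xm' Cm pp'.
by have [m1 [? ? ?]] := coherent_letter xm xm' Cm a0 aS mm'; exists m1.
Qed.

End Coherent.

End Semantics.

(** * The relation between the two nets *)

Section Equivalence.

Variables (K : choiceType) (Sigma : pred nat) (N1 N2 : net K Sigma).
Variables (C1 : pform (place N1)) (C2 : pform (place N2)).
Variable E : pform (allplace N1 N2).

(** [Eequiv] is itself an instance of [Etilde], so both sides evaluate [E] and the shared-place
    equalities under pointwise equal assignments. *)
Lemma sat_Etilde (V : Type) (e : V -> nat) (x : place N1 -> V)
    (y : place N2 -> V) (m1 : marking N1) (m2 : marking N2) :
  e \o x =1 m1 -> e \o y =1 m2 -> sat e (Etilde E x y) <-> Eequiv E m1 m2.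
Proof.
move=> xm ym; rewrite /Eequiv /=.
have er : e \o (fun v => scase x y (side v)) =1
    scase m1 m2 \o (fun v => scase inl inr (side v)).
  by move=> v /=; case: (side v) => p /=; [apply: xm | apply: ym].
have -> : sat e (rename (fun v => scase x y (side v)) E) <->
    sat (scase m1 m2) (rename (fun v => scase inl inr (side v)) E).
  by rewrite (sat_rename _ er) (sat_rename _ (frefl _)).
have h : sat e (FConj [seq FEq (TVar (x pq.1)) (TVar (y pq.2))
      | pq <- enum {: place N1 * place N2} & val pq.1 == val pq.2]) <->
    sat (scase m1 m2) (FConj [seq FEq (TVar (inl pq.1)) (TVar (inr pq.2))
      | pq <- enum {: place N1 * place N2} & val pq.1 == val pq.2]).
  rewrite !sat_FConj; split=> H pq /H /=.
    by have /= -> := xm pq.1; have /= -> := ym pq.2.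
  by have /= -> := xm pq.1; have /= -> := ym pq.2.
by rewrite h.
Qed.

Hypothesis absE : abstracts C1 E C2.

Lemma valid_core1 : valid (core1 C1 E C2).
Proof.
move=> e0 m1 /= /(sat_appC (scase_inr _ m1)) Cm1; have [S1 _ _] := absE.
have [m2 [_ Em Cm2]] := S1 _ Cm1; exists m2; split.
  by apply/(sat_Etilde (m1 := m1) (m2 := m2)).
exact/(sat_appC (scase_inr _ m2)).
Qed.

Lemma valid_core2 : valid (core2 E).
Proof.
move=> e0 v; rewrite /core2; set e := scase e0 v => -[Ep pp'].
pose m1 : marking N1 := [ffun i => v (inl (inl i))].
pose m2 : marking N2 := [ffun i => v (inl (inr i))].
pose m1' : marking N1 := [ffun i => v (inr i)].
have xm1 : e \o (fun i => inr (inl (inl i))) =1 m1 by move=> i; rewrite ffunE.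
have xm2 : e \o (fun i => inr (inl (inr i))) =1 m2 by move=> i; rewrite ffunE.
have xm1' : e \o (fun i => inr (inr i)) =1 m1' by move=> i; rewrite ffunE.
have [_ S2 _] := absE.
have [t t0 mt] := (sat_tauform xm1 xm1').1 pp'.
apply/(sat_Etilde xm1' xm2); apply: S2 ((sat_Etilde xm1 xm2).1 Ep).
(* The label of [t] is 0, so the filter erases it and the word is empty. *)
by have := wreach_fire mt; rewrite /= t0.
Qed.

Variables (tauS1 : pform (place N1 + place N1)).
Variables (tauS2 : pform (place N2 + place N2)).
Hypotheses (coh1 : coherent C1) (coh2 : coherent C2).
Hypotheses (tauS1P : silent_reach_formula C1 tauS1).
Hypotheses (tauS2P : silent_reach_formula C2 tauS2).

Lemma valid_core3 : valid (core3 C1 tauS1 E C2 tauS2).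
Proof.
move=> e0 v; rewrite /core3; set e := scase e0 v => -[Cp1 [Ep [Cp2 [T1 Ep']]]].
pose m1 : marking N1 := [ffun i => v (inl (inl (inl (inl i))))].
pose m2 : marking N2 := [ffun i => v (inl (inl (inl (inr i))))].
pose m1' : marking N1 := [ffun i => v (inl (inr i))].
pose m2' : marking N2 := [ffun i => v (inr i)].
have xm1 : e \o (fun i => inr (inl (inl (inl (inl i))))) =1 m1.
  by move=> i; rewrite ffunE.
have xm2 : e \o (fun i => inr (inl (inl (inl (inr i))))) =1 m2.
  by move=> i; rewrite ffunE.
have xm1' : e \o (fun i => inr (inl (inr i))) =1 m1' by move=> i; rewrite ffunE.
have xm2' : e \o (fun i => inr (inr i)) =1 m2' by move=> i; rewrite ffunE.
have [_ _ S3] := absE.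
have Cm1 := (sat_appC xm1 _).1 Cp1; have Cm2 := (sat_appC xm2 _).1 Cp2.
have [s [sS mm' sa]] := (sat_That tauS1P coh1 _ xm1 xm1' Cm1).1 T1.
(* The word [s] found in the first net, empty or the letter [e a], is the witness for the second, so
   a single use of (S3) settles both cases. *)
apply/(sat_That tauS2P coh2 _ xm2 xm2' Cm2); exists s; split=> //.
apply: S3 mm' _ _ _ ((sat_Etilde xm1' xm2').1 Ep') => //.
by split=> //; apply/(sat_Etilde xm1 xm2).
Qed.

End Equivalence.

Unset Implicit Arguments.

Theorem theorem4 (K : choiceType) (Sigma : pred nat) (Sigma0 : 0 \notin Sigma)
    (N1 N2 : net K Sigma)
    (C1 : pform (place N1)) (C2 : pform (place N2)) (E : pform (allplace N1 N2))
    (tauS1 : pform (place N1 + place N1)) (tauS2 : pform (place N2 + place N2))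
    (coh1 : coherent C1) (coh2 : coherent C2)
    (tauS1P : silent_reach_formula C1 tauS1)
    (tauS2P : silent_reach_formula C2 tauS2)
    (absE : abstracts C1 E C2) :
  [/\ valid (core0 C1 tauS1) /\ valid (core0 C2 tauS2),
      valid (core1 C1 E C2),
      valid (core2 E)
    & valid (core3 C1 tauS1 E C2 tauS2)].
Proof.
split; first by split; apply: valid_core0.
- exact: valid_core1.
- exact: valid_core2 absE.
- exact: valid_core3.
Qed.
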